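(* For every scheme $\mathbf{X}\in\mathcal{S}$, the following split interpolation property fails: for all formulas $\phi,\psi\in\mathcal{L}$, if $\mathit{At}(\phi)\cap\mathit{At}(\psi)\neq\emptyset$ and $\models_{\mathbf{X}}^{\mathbf{st}}\phi\Rightarrow\psi$, then there is a formula $\chi\in\mathcal{L}$ with $\mathit{At}(\chi)\subseteq\mathit{At}(\phi)\cap\mathit{At}(\psi)$ such that $\models_{\mathbf{X}}^{\mathbf{ss}}\phi\Rightarrow\chi$ and $\models_{\mathbf{X}}^{\mathbf{tt}}\chi\Rightarrow\psi$.
   Context: Language: $\mathit{Var}$ is a countably infinite set of atoms; $\mathcal{L}$ is the set of formulas built from $\mathit{Var}$ using unary $\neg$ and binary $\wedge,\lor$ (no propositional constants). $\mathit{At}(\phi)$ is the set of atoms occurring in $\phi$. Schemes: let $\mathcal{V}=\{0,\frac12,1\}$. A scheme is a triple $\mathbf{X}=\langle f^\neg,f^\wedge,f^\lor\rangle$ of operations on $\mathcal{V}$ (of arities 1, 2, 2). An $\mathbf{X}$-valuation is a map $v:\mathcal{L}\to\mathcal{V}$ with $v(\neg\phi)=f^\neg(v(\phi))$, $v(\phi\wedge\chi)=f^\wedge(v(\phi),v(\chi))$, $v(\phi\lor\chi)=f^\lor(v(\phi),v(\chi))$ (arbitrary on atoms). All schemes considered here satisfy $f^\neg(1)=0$, $f^\neg(\frac12)=\frac12$, $f^\neg(0)=1$; $f^\wedge$ and $f^\lor$ are classical on $\{0,1\}$; $f^\wedge(1,\frac12)=f^\wedge(\frac12,1)=f^\wedge(\frac12,\frac12)=\frac12$;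 $f^\lor(0,\frac12)=f^\lor(\frac12,0)=f^\lor(\frac12,\frac12)=\frac12$. The scheme $\mathbf{X}_\wedge/\mathbf{Y}_\lor$ is determined by the remaining values: - the pair $(f^\wedge(0,\frac12),f^\wedge(\frac12,0))$ is $(\frac12,\frac12)$ for $\mathbf{WK}_\wedge$, $(0,\frac12)$ for $\mathbf{LMK}_\wedge$, $(\frac12,0)$ for $\mathbf{RMK}_\wedge$; - the pair $(f^\lor(1,\frac12),f^\lor(\frac12,1))$ is $(\frac12,\frac12)$ for $\mathbf{WK}_\lor$, $(1,\frac12)$ for $\mathbf{LMK}_\lor$, $(\frac12,1)$ for $\mathbf{RMK}_\lor$. The set $\mathcal{S}$ consists of the eight schemes $\mathbf{LMK}_{\wedge}/\mathbf{LMK}_{\lor}$, $\mathbf{LMK}_{\wedge}/\mathbf{RMK}_{\lor}$, $\mathbf{LMK}_{\wedge}/\mathbf{WK}_{\lor}$, $\mathbf{RMK}_{\wedge}/\mathbf{LMK}_{\lor}$, $\mathbf{RMK}_{\wedge}/\mathbf{RMK}_{\lor}$, $\mathbf{RMK}_{\wedge}/\mathbf{WK}_{\lor}$, $\mathbf{WK}_{\wedge}/\mathbf{LMK}_{\lor}$, $\mathbf{WK}_{\wedge}/\mathbf{RMK}_{\lor}$. Consequence: let $\mathbf{s}=\{1\}$, $\mathbf{t}=\{1,\frac12\}$. For $\mathbf{x},\mathbf{y}\in\{\mathbf{s},\mathbf{t}\}$, $\models_{\mathbf{X}}^{\mathbf{xy}}\phi\Rightarrow\psi$ means: for every $\mathbf{X}$-valuation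 $v$, if $v(\phi)\in\mathbf{x}$ then $v(\psi)\in\mathbf{y}$. *)

(* Defs.v *)
From mathcomp Require Import all_boot.
From mathcomp Require Import classical_sets.

Set Implicit Arguments.
Unset Strict Implicit.
Unset Printing Implicit Defensive.

Local Open Scope classical_set_scope.

Inductive formula (Var : Type) : Type :=
| Atom of Var
| Neg of formula Var
| And of formula Var & formula Var
| Or of formula Var & formula Var.

Fixpoint At (Var : Type) (phi : formula Var) : set Var :=
  match phi with
  | Atom p => [set p]
  | Neg phi1 => At phi1
  | And phi1 phi2 => At phi1 `|` At phi2
  | Or phi1 phi2 => At phi1 `|` At phi2
  end.

Inductive truth_value : Type := V0 | Vhalf | V1.

Record scheme : Type := Scheme {
  f_neg : truth_value -> truth_value;
  f_and : truth_value -> truth_value -> truth_value;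
  f_or : truth_value -> truth_value -> truth_value
}.

Definition neg3 (a : truth_value) : truth_value :=
  match a with V0 => V1 | Vhalf => Vhalf | V1 => V0 end.

(* The parameters a and b are the values at (0, 1/2) and (1/2, 0). *)
Definition conj3 (a b : truth_value) (x y : truth_value) : truth_value :=
  match x, y with
  | V1, V1 => V1
  | V1, V0 | V0, V1 | V0, V0 => V0
  | V1, Vhalf | Vhalf, V1 | Vhalf, Vhalf => Vhalf
  | V0, Vhalf => a
  | Vhalf, V0 => b
  end.

(* The parameters a and b are the values at (1, 1/2) and (1/2, 1). *)
Definition disj3 (a b : truth_value) (x y : truth_value) : truth_value :=
  match x, y with
  | V0, V0 => V0
  | V1, V0 | V0, V1 | V1, V1 => V1
  | V0, Vhalf | Vhalf, V0 | Vhalf, Vhalf => Vhalf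
  | V1, Vhalf => a
  | Vhalf, V1 => b
  end.

Definition WK_and := conj3 Vhalf Vhalf.
Definition LMK_and := conj3 V0 Vhalf.
Definition RMK_and := conj3 Vhalf V0.

Definition WK_or := disj3 Vhalf Vhalf.
Definition LMK_or := disj3 V1 Vhalf.
Definition RMK_or := disj3 Vhalf V1.

Definition schemes_S : set scheme :=
  [set Scheme neg3 LMK_and LMK_or;
       Scheme neg3 LMK_and RMK_or;
       Scheme neg3 LMK_and WK_or;
       Scheme neg3 RMK_and LMK_or;
       Scheme neg3 RMK_and RMK_or;
       Scheme neg3 RMK_and WK_or;
       Scheme neg3 WK_and LMK_or;
       Scheme neg3 WK_and RMK_or].

Definition is_valuation (Var : Type) (X : scheme) (v : formula Var -> truth_value) :
    Prop :=
  [/\ forall phi, v (Neg phi) = f_neg X (v phi),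
      forall phi chi, v (And phi chi) = f_and X (v phi) (v chi) &
      forall phi chi, v (Or phi chi) = f_or X (v phi) (v chi)].

Definition s_std : set truth_value := [set V1].
Definition t_std : set truth_value := [set V1; Vhalf].

Definition entails (Var : Type) (X : scheme) (x y : set truth_value)
    (phi psi : formula Var) : Prop :=
  forall v : formula Var -> truth_value, is_valuation X v -> x (v phi) -> y (v psi).

Definition split_interpolation (Var : Type) (X : scheme) : Prop :=
  forall phi psi : formula Var,
    At phi `&` At psi !=set0 ->
    entails X s_std t_std phi psi ->
    exists chi : formula Var,
      [/\ At chi `<=` At phi `&` At psi,
          entails X s_std s_std phi chi &
          entails X t_std t_std chi psi].

(* Main.v *)
Require Import Defs.
From mathcomp Require Import all_boot.
From mathcomp Require Import classical_sets cardinality.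

(** The obstruction is that the value 1/2 is a fixed point of every connective,
    so a formula all of whose atoms have value 1/2 has value 1/2 itself
    ([valuation_half]), whereas in each scheme of the family one of the
    connectives lets a classical argument override a 1/2 on its other side.
    Hence some formula [phi] in the atoms [p], [q] has value 1 although [p] has
    value 1/2 ([phi_true_at_half]): take the disjunction of [p] and [q], or the
    negation of the conjunction of [p] and the negation of [q], with the
    arguments in the order that the scheme requires.

    Take as [psi] the excluded middle for [p]. It never has value 0, so [phi]
    st-entails it, and the only shared atom is [p]. An interpolant would be a
    formula in [p] alone; at a valuation with [p] at 1/2 and [q] at 1 it has
    value 1/2 while [phi] has value 1, so the ss-half of the split already
    fails. *)

Local Open Scope classical_set_scope.
Local Open Scope card_scope.

Fixpoint eval (Var : Type) (X : scheme) (a : Var -> truth_value)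
    (phi : formula Var) : truth_value :=
  match phi with
  | Atom p => a p
  | Neg phi1 => f_neg X (eval Var X a phi1)
  | And phi1 phi2 => f_and X (eval Var X a phi1) (eval Var X a phi2)
  | Or phi1 phi2 => f_or X (eval Var X a phi1) (eval Var X a phi2)
  end.

Lemma eval_valuation (Var : Type) (X : scheme) (a : Var -> truth_value) :
  is_valuation X (eval Var X a).
Proof. by []. Qed.

Lemma valuation_half (Var : Type) (X : scheme) (v : formula Var -> truth_value)
    (chi : formula Var) :
  f_neg X Vhalf = Vhalf -> f_and X Vhalf Vhalf = Vhalf ->
  f_or X Vhalf Vhalf = Vhalf -> is_valuation X v ->
  (forall p, At chi p -> v (Atom p) = Vhalf) -> v chi = Vhalf.
Proof.
move=> negh andh orh [vneg vand vor].
elim: chi => [p|c IHc|c IHc d IHd|c IHc d IHd] /= hh.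
- exact: hh.
- by rewrite vneg IHc.
- by rewrite vand IHc ?IHd // => p cp; apply: hh; [right | left].
- by rewrite vor IHc ?IHd // => p cp; apply: hh; [right | left].
Qed.

Lemma schemes_S_half (X : scheme) : schemes_S X ->
  [/\ f_neg X Vhalf = Vhalf, f_and X Vhalf Vhalf = Vhalf
    & f_or X Vhalf Vhalf = Vhalf].
Proof. by case=> [[[[[[[->|->]|->]|->]|->]|->]|->]|->]. Qed.

Definition has_formula_true_at_half (Var : Type) (X : scheme) (p q : Var) : Prop :=
  exists2 phi : formula Var, At phi p &
    forall v, is_valuation X v -> v (Atom p) = Vhalf -> v (Atom q) = V1 ->
      v phi = V1.

(** No scheme in the family is weak Kleene in both binary connectives: in at
    least one of them, a classical argument on one side overrides 1/2. *)
Lemma phi_true_at_half (Var : Type) (X : scheme) (p q : Var) :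
  schemes_S X -> has_formula_true_at_half Var X p q.
Proof.
have orL Y : f_or Y V1 Vhalf = V1 -> has_formula_true_at_half Var Y p q.
  move=> oY; exists (Or (Atom q) (Atom p)); first by right.
  by move=> v [_ _ vor] vp vq; rewrite vor vp vq.
have orR Y : f_or Y Vhalf V1 = V1 -> has_formula_true_at_half Var Y p q.
  move=> oY; exists (Or (Atom p) (Atom q)); first by left.
  by move=> v [_ _ vor] vp vq; rewrite vor vp vq.
case=> [[[[[[[->|->]|->]|->]|->]|->]|->]|->];
  try by [apply: orL | apply: orR].
(* Disjunction is weak Kleene in the two schemes that remain. *)
- exists (Neg (And (Neg (Atom q)) (Atom p))); first by right.
  by move=> v [vneg vand _] vp vq; rewrite !(vneg, vand) vp vq.
- exists (Neg (And (Atom p) (Neg (Atom q)))); first by left.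
  by move=> v [vneg vand _] vp vq; rewrite !(vneg, vand) vp vq.
Qed.

Lemma excluded_middle_tolerant (Var : Type) (X : scheme) (p : Var)
    (v : formula Var -> truth_value) :
  schemes_S X -> is_valuation X v -> t_std (v (Or (Atom p) (Neg (Atom p)))).
Proof.
move=> HX [vneg _ vor]; rewrite vor vneg.
by move: HX; case=> [[[[[[[->|->]|->]|->]|->]|->]|->]|->];
  case: (v (Atom p)); (by left) || (by right).
Qed.

Theorem corollary4p17 (Var : Type) (HVar : [set: Var] #= [set: nat])
    (X : scheme) (HX : schemes_S X) :
  ~ split_interpolation Var X.
Proof.
move=> interp.
have /card_set_bijP[g [_ _ gsurj]] := HVar.
have [p _ gp] := gsurj 0 I.
have [q _ gq] := gsurj 1 I.
have [phi phip phi1] := phi_true_at_half Var X p q HX.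
have [||chi [chiAt phichi _]] := interp phi (Or (Atom p) (Neg (Atom p))).
- by exists p; split=> //; left.
- by move=> v Xv _; exact: excluded_middle_tolerant HX Xv.
(* The numbering [g] separates [p] from [q], which makes the valuation
   sending [q] to 1 and [p] to 1/2 definable by a boolean test. *)
pose v := eval Var X (fun x => if g x == 1 then V1 else Vhalf).
have Xv : is_valuation X v by exact: eval_valuation.
have vp : v (Atom p) = Vhalf by rewrite /v /= gp.
have vq : v (Atom q) = V1 by rewrite /v /= gq.
have chi1 : v chi = V1 by apply: phichi (phi1 _ Xv vp vq).
have [negh andh orh] := schemes_S_half X HX.
suff chih : v chi = Vhalf by rewrite chih in chi1.
by apply: valuation_half Xv _ => // r /chiAt[_ [] ->].
Qed.
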